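(* Let $M$ be a delta-matroid over a finite ground set $V$ that is $\mathrm{inv}$-representable over $GF(4)$. Then for every finite sequence $\varphi$ of operations, each of the form $*u$ (pivot) or $+u$ (loop complementation) with $u\in V$, the set system $M\varphi$ is again a delta-matroid that is $\mathrm{inv}$-representable over $GF(4)$.
   Context: A set system over $V$ is a pair $M=(V,E)$ with $E\subseteq 2^V$; write $Y\in M$ for $Y\in E$. Pivot (twist): for $X\subseteq V$, $M*X=(V,\{Y\triangle X\mid Y\in E\})$; $M*u=M*\{u\}$. Loop complementation: for $u\in V$, $M+u=(V,E')$ with $E'=E\triangle\{Y\cup\{u\}\mid Y\in E,\ u\notin Y\}$. Operations are applied left to right. A delta-matroid is a set system with $E\neq\emptyset$ satisfying the symmetric exchange axiom: for all $X,Y\in M$ and $u\in X\triangle Y$, either $X\triangle\{u\}\in M$ or there is $v\in X\triangle Y$, $v\neq u$, with $X\triangle\{u,v\}\in M$. For a $V\times V$-matrix $A$, $\mathcal{M}_A=(V,\{X\subseteq V\mid A[X]\text{ nonsingular}\})$, where $A[X]$ is the principal submatrix on $X$ and the empty matrix is nonsingular. $\mathrm{inv}$ is the nontrivial automorphism $x\mapsto x^2$ of $GF(4)$, applied entrywise; a matrix $A$ over $GF(4)$ is $\mathrm{inv}$-symmetric if $\mathrm{inv}(-A^T)=A$. A delta-matroid $M$ is $\mathrm{inv}$-representable over $GF(4)$ if $M=\mathcal{M}_A*X$ for some $\mathrm{inv}$-symmetric $V\times V$-matrix $A$ over $GF(4)$ and some $X\subseteq V$. *)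

(* Defs.v *)
From HB Require Import structures.
From mathcomp Require Import all_boot all_order all_algebra.

Set Implicit Arguments.
Unset Strict Implicit.
Unset Printing Implicit Defensive.

Import GRing.Theory.
Local Open Scope ring_scope.

Definition symdiff (V : finType) (X Y : {set V}) : {set V} :=
  (X :\: Y) :|: (Y :\: X).

(* The ground set V is a type, so a set system (V, E) is given by E alone. *)
Definition set_system (V : finType) := {set {set V}}.

Definition pivot (V : finType) (M : set_system V) (X : {set V}) :
  set_system V := [set symdiff Y X | Y in M].

Definition loop_compl (V : finType) (M : set_system V) (u : V) :
  set_system V := symdiff M [set u |: Y | Y : {set V} in M & u \notin Y].

Inductive vertex_op (V : finType) : Type :=
  | OpPivot of V
  | OpLoopCompl of V.

Definition apply_op (V : finType) (M : set_system V) (o : vertex_op V) :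
  set_system V :=
  match o with
  | OpPivot u => pivot M [set u]
  | OpLoopCompl u => loop_compl M u
  end.

Definition apply_ops (V : finType) (M : set_system V)
  (phi : seq (vertex_op V)) : set_system V := foldl (@apply_op V) M phi.

Definition delta_matroid (V : finType) (M : set_system V) : Prop :=
  M <> set0 /\
  forall X Y : {set V}, X \in M -> Y \in M ->
  forall u : V, u \in symdiff X Y ->
    symdiff X [set u] \in M \/
    exists v : V, [/\ v \in symdiff X Y, v <> u & symdiff X [set u; v] \in M].

(* A V x V matrix is an element of 'M[F]_#|V|; the row and column of x : V are
   those of index enum_rank x. *)
Definition principal_submx (V : finType) (F : fieldType) (A : 'M[F]_#|V|)
  (X : {set V}) : 'M[F]_#|X| :=
  mxsub (fun i : 'I_#|X| => enum_rank (enum_val i))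
        (fun j : 'I_#|X| => enum_rank (enum_val j)) A.

(* The 0 x 0 matrix has determinant 1, so set0 is always a member. *)
Definition matrix_system (V : finType) (F : fieldType) (A : 'M[F]_#|V|) :
  set_system V := [set X : {set V} | principal_submx A X \in unitmx].

(* Meant for #|F| = 4, where x |-> x ^+ 2 is the nontrivial automorphism. *)
Definition inv4 (F : finFieldType) (x : F) : F := x ^+ 2.

Definition inv_symmetric (F : finFieldType) (n : nat) (A : 'M[F]_n) : Prop :=
  map_mx (@inv4 F) (- A^T) = A.

Definition inv_representable (F : finFieldType) (V : finType)
  (M : set_system V) : Prop :=
  exists (A : 'M[F]_#|V|) (X : {set V}),
    inv_symmetric A /\ M = pivot (matrix_system A) X.

(* Main.v *)
(** Let C be the class of the systems M_A with A inv-symmetric. Over GF(4) this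
    means Hermitian, so the principal minors lie in GF(2). Hence adding 1 to a
    diagonal entry realizes loop complementation inside C, and a Schur
    complement realizes the pivot on u inside C whenever {u} is feasible. On a
    single element, pivot and loop complementation satisfy
    *u +u = +u *u +u *u; since one of {u} in M and {u} in M + u holds, this
    reduces M_A *u +u to the two cases above, up to a final pivot on u. For
    the exchange axiom, the same relation shows that pivoting a member of C on
    any feasible set stays in C, so it is enough to exchange from the empty
    set, where a nonzero entry in row u gives a nonsingular 1 x 1 or 2 x 2
    principal submatrix. *)

Require Import Defs.
From mathcomp Require Import all_boot all_order all_fingroup.
From mathcomp Require Import all_algebra all_field.

Set Implicit Arguments.
Unset Strict Implicit.
Unset Printing Implicit Defensive.

Import GRing.Theory.

(** * Membership calculus for pivots and loop complementation *)

Section SetSystems.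

Variable V : finType.
Implicit Types (X Y Z : {set V}) (M N : set_system V) (u v : V).

Lemma in_symdiff (T : finType) (X Y : {set T}) x :
  (x \in symdiff X Y) = (x \in X) (+) (x \in Y).
Proof. by rewrite !inE; case: (x \in X); case: (x \in Y). Qed.

Lemma symdiffC X Y : symdiff X Y = symdiff Y X.
Proof. by apply/setP=> x; rewrite !in_symdiff addbC. Qed.

Lemma symdiffA X Y Z : symdiff X (symdiff Y Z) = symdiff (symdiff X Y) Z.
Proof. by apply/setP=> x; rewrite !in_symdiff addbA. Qed.

Lemma symdiff0 X : symdiff X set0 = X.
Proof. by apply/setP=> x; rewrite in_symdiff inE addbF. Qed.

Lemma symdiffv X : symdiff X X = set0.
Proof. by apply/setP=> x; rewrite in_symdiff inE addbb. Qed.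

Lemma symdiffK X Y : symdiff (symdiff X Y) Y = X.
Proof. by rewrite -symdiffA symdiffv symdiff0. Qed.

Lemma symdiff1 Y u : symdiff Y [set u] = if u \in Y then Y :\ u else u |: Y.
Proof.
apply/setP=> x; rewrite in_symdiff (fun_if (fun S : {set V} => x \in S)) !inE.
by have [->|_] := eqVneq x u; case: (u \in Y); rewrite ?addbF.
Qed.

Lemma in_pivot M X Y : (Y \in pivot M X) = (symdiff Y X \in M).
Proof.
apply/imsetP/idP => [[Z MZ ->]|MY]; first by rewrite symdiffK.
by exists (symdiff Y X); rewrite ?symdiffK.
Qed.

Lemma pivotM M X Y : pivot (pivot M X) Y = pivot M (symdiff X Y).
Proof. by apply/setP=> Z; rewrite !in_pivot (symdiffC X) symdiffA. Qed.

Lemma pivot0 M : pivot M set0 = M.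
Proof. by apply/setP=> Z; rewrite in_pivot symdiff0. Qed.

Lemma in_loop_compl M u Y :
  (Y \in loop_compl M u) = (Y \in M) (+) ((u \in Y) && (Y :\ u \in M)).
Proof.
rewrite in_symdiff; congr (_ (+) _).
apply/imsetP/andP => [[Z /[!inE] /andP[MZ uZ] ->]|[uY MY]].
  by rewrite setU11 setU1K.
by exists (Y :\ u); rewrite ?inE ?eqxx ?MY // setD1K.
Qed.

Lemma loop_complK M u : loop_compl (loop_compl M u) u = M.
Proof.
apply/setP=> Y; rewrite !in_loop_compl setD11 /= addbF.
by rewrite -addbA addbb addbF.
Qed.

Lemma pivot_loop_complC M X u : u \notin X ->
  loop_compl (pivot M X) u = pivot (loop_compl M u) X.
Proof.
move=> uX; apply/setP=> Y; rewrite in_loop_compl !in_pivot in_loop_compl.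
have -> : symdiff (Y :\ u) X = symdiff Y X :\ u.
  apply/setP=> x; rewrite in_setD1 !in_symdiff in_setD1.
  by have [->|_] := eqVneq x u; rewrite ?(negPf uX).
by rewrite in_symdiff (negPf uX) addbF.
Qed.

(** Operations on [u] act separately on each pair [Z], [u |: Z], so identities between them reduce
    to a check on two bits. *)
Lemma eq_set_system1 u M N :
    (forall Z, u \notin Z ->
      (Z \in M) = (Z \in N) /\ (u |: Z \in M) = (u |: Z \in N)) ->
  M = N.
Proof.
move=> eqMN; apply/setP=> Y; have [uY|uY] := boolP (u \in Y).
  by have [_] := eqMN (Y :\ u) (negbT (setD11 _ _)); rewrite setD1K.
by have [] := eqMN Y uY.
Qed.

Section Elementary.

Variables (M : set_system V) (u : V) (Z : {set V}).
Hypothesis uZ : u \notin Z.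

Lemma in_pivot1 : (Z \in pivot M [set u]) = (u |: Z \in M).
Proof. by rewrite in_pivot symdiff1 (negPf uZ). Qed.

Lemma in_pivot1U : (u |: Z \in pivot M [set u]) = (Z \in M).
Proof. by rewrite in_pivot symdiff1 setU11 setU1K. Qed.

Lemma in_loop_compl0 : (Z \in loop_compl M u) = (Z \in M).
Proof. by rewrite in_loop_compl (negPf uZ) addbF. Qed.

Lemma in_loop_complU :
  (u |: Z \in loop_compl M u) = (u |: Z \in M) (+) (Z \in M).
Proof. by rewrite in_loop_compl setU11 setU1K. Qed.

(** On the two bits of the pair [Z], [u |: Z], the pivot is the swap and loop complementation adds
    the first bit to the second. *)
Definition in_elementary :=
  (in_pivot1, in_pivot1U, in_loop_compl0, in_loop_complU).

End Elementary.

(* Pivot and loop complementation on u generate a copy of S_3. *)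
Lemma pivot_loop_compl_braid M u :
  loop_compl (pivot M [set u]) u =
  pivot (loop_compl (pivot (loop_compl M u) [set u]) u) [set u].
Proof.
apply: (@eq_set_system1 u) => Z uZ; rewrite !(in_elementary _ uZ).
by case: (_ \in M); case: (_ \in M).
Qed.

End SetSystems.

(** * Principal minors over an arbitrary field *)

Section PrincipalMinors.

Local Open Scope ring_scope.

Variables (V : finType) (F : fieldType).
Implicit Types (A : 'M[F]_#|V|) (X Z : {set V}) (u v : V).

(** Two enumerations of the same index set differ by a permutation [h]. It acts on rows and columns
    alike, so its sign occurs squared. *)
Lemma det_mxsub_reindex n k m (A : 'M[F]_n) (f : 'I_k -> 'I_n)
    (g : 'I_m -> 'I_n) :
    injective f -> injective g -> f @: 'I_k = g @: 'I_m ->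
  \det (mxsub f f A) = \det (mxsub g g A).
Proof.
move=> injf injg eq_fg.
have eq_km : k = m.
  by rewrite -[k]card_ord -[m]card_ord -(card_imset _ injf) eq_fg card_imset.
case: _ / eq_km g injg eq_fg => g injg eq_fg.
have hP i : {j | f i == g j}.
  apply: sigW; have /imsetP[j _ ->] : f i \in g @: 'I_k by rewrite -eq_fg imset_f.
  by exists j; exact: eqxx.
pose h i := sval (hP i); have fE i : f i = g (h i) := eqP (svalP (hP i)).
have injh : injective h by move=> i j eq_ij; apply: injf; rewrite !fE eq_ij.
have -> : mxsub f f A = row_perm (perm injh) (col_perm (perm injh) (mxsub g g A)).
  by apply/matrixP=> i j; rewrite !mxE !permE !fE.
rewrite row_permE col_permE !det_mulmx !det_perm odd_permV.
by rewrite mulrCA -expr2 sqrr_sign mulr1.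
Qed.

Lemma det_principal_submxU1 A u Z : u \notin Z ->
  \det (principal_submx A (u |: Z)) =
  \det (block_mx (A (enum_rank u) (enum_rank u))%:M
    (\row_j A (enum_rank u) (enum_rank (enum_val j : V)))
    (\col_i A (enum_rank (enum_val i : V)) (enum_rank u))
    (principal_submx A Z)).
Proof.
move=> uZ; pose f (i : 'I_(1 + #|Z|)) :=
  enum_rank (match split i with inl _ => u | inr j => enum_val j end).
set B := block_mx _ _ _ _; have -> : B = mxsub f f A.
  apply/matrixP=> i j; rewrite /f [RHS]mxE mxE.
  by case: split => i'; rewrite mxE; case: split => j'; rewrite !mxE ?ord1.
apply: det_mxsub_reindex.
- by move=> i j /enum_rank_inj /enum_val_inj.
- move=> i j /enum_rank_inj eq_ij; apply/(can_inj (@splitK _ _)); move: eq_ij.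
  case: split => i'; case: split => j'; rewrite ?ord1 //.
  + by move=> uE; have := enum_valP j'; rewrite -uE (negPf uZ).
  + by move=> uE; have := enum_valP i'; rewrite uE (negPf uZ).
  + by move/enum_val_inj->.
apply/setP=> r; apply/imsetP/imsetP => [[i _ ->]|[i _ ->]].
  have /setU1P[->|iZ] := enum_valP i.
    by exists (lshift _ 0) => //; rewrite /f -[lshift _ _]/(unsplit (inl _)) unsplitK.
  exists (rshift _ (enum_rank_in iZ (enum_val i))) => //.
  by rewrite /f -[rshift _ _]/(unsplit (inr _)) unsplitK enum_rankK_in.
have fU : (match split i with inl _ => u | inr j => enum_val j end) \in u |: Z.
  by case: split => j; [rewrite setU11 | rewrite setU1r ?enum_valP].
exists (enum_rank_in fU (enum_val (f i))) => //.
by rewrite /f enum_rankK enum_rankK_in.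
Qed.

Lemma det_principal_submx0 A : \det (principal_submx A set0) = 1.
Proof. by move: (principal_submx _ _); rewrite cards0 => B; rewrite det_mx00. Qed.

Lemma principal_submxD_delta A u Z t : u \notin Z ->
  principal_submx (A + t *: delta_mx (enum_rank u) (enum_rank u)) Z =
  principal_submx A Z.
Proof.
move=> uZ; apply/matrixP=> i j; rewrite !mxE (inj_eq enum_rank_inj).
case: eqP => [iu|_]; last by rewrite mulr0 addr0.
by have := enum_valP i; rewrite iu (negPf uZ).
Qed.

Lemma det_block_mxDl n (a t : F) (b : 'rV_n) (c : 'cV_n) (D : 'M_n) :
  \det (block_mx (a + t)%:M b c D) = \det (block_mx a%:M b c D) + t * \det D.
Proof.
have row'E (x y : 'M[F]_1) (b1 b2 : 'M[F]_(1, n)) :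
  row' (lshift n 0) (block_mx x b1 c D) = row' (lshift n 0) (block_mx y b2 c D).
  apply/matrixP=> i j; rewrite !mxE.
  by case: (splitP (lift _ i)) => k /=; rewrite ?ord1.
rewrite -(mul1r (\det (block_mx a%:M b c D))).
(* With [\det D] written this way, the claim is linearity in the first row: (a + t, b) = (a, b) + t
   (1, 0). *)
have <- : \det (block_mx 1%:M 0 c D) = \det D by rewrite det_lblock det1 mul1r.
apply: (@determinant_multilinear _ _ _ _ _ (lshift _ 0)); [|exact: row'E..].
rewrite /block_mx !rowKu; apply/rowP=> j; rewrite !mxE.
case: (split j) => k; rewrite mul1r; last by rewrite !mxE mulr0 addr0.
by rewrite !mxE !ord1 eqxx !mulr1n mulr1.
Qed.

Lemma det_principal_submxD_delta A u Z t : u \notin Z ->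
  \det (principal_submx (A + t *: delta_mx (enum_rank u) (enum_rank u)) (u |: Z)) =
  \det (principal_submx A (u |: Z)) + t * \det (principal_submx A Z).
Proof.
move=> uZ; set r := enum_rank u; set A' := A + _.
have rE (x : V) : (enum_rank x == r) = (x == u) by rewrite (inj_eq enum_rank_inj).
have neq_u (i : 'I_#|Z|) : (enum_val i == u) = false.
  by apply/eqP => iu; have := enum_valP i; rewrite iu (negPf uZ).
rewrite !det_principal_submxU1 // principal_submxD_delta // -/r.
have -> : A' r r = A r r + t by rewrite !mxE !eqxx mulr1.
set c := \col_i A _ r; set b := \row_j A r _.
have -> : \col_i A' (enum_rank (enum_val i)) r = c.
  by apply/matrixP=> i j; rewrite !mxE rE neq_u mulr0 addr0.
have -> : \row_j A' r (enum_rank (enum_val j)) = b.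
  by apply/matrixP=> i j; rewrite !mxE rE neq_u andbF mulr0 addr0.
exact: det_block_mxDl.
Qed.

Lemma det_principal_submx_schur A u Z :
    u \notin Z -> A (enum_rank u) (enum_rank u) = 1 ->
  \det (principal_submx A (u |: Z)) =
  \det (principal_submx (A - col (enum_rank u) A *m row (enum_rank u) A) Z).
Proof.
move=> uZ Auu; rewrite det_principal_submxU1 // Auu.
set c := \col_i A _ _; set b := \row_j A _ _.
have -> : principal_submx A Z = c *m b +
    principal_submx (A - col (enum_rank u) A *m row (enum_rank u) A) Z.
  by apply/matrixP=> i j; rewrite !mxE !big_ord1 !mxE addrC subrK.
set S := principal_submx _ Z.
(* Block LU factorization; the pivot entry is 1, so no inverse appears. *)
have -> : block_mx 1%:M b c (c *m b + S) =
    block_mx 1%:M 0 c 1%:M *m block_mx 1%:M b 0 S.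
  by rewrite mulmx_block !(mul0mx, mulmx0, mul1mx, mulmx1, addr0).
by rewrite det_mulmx det_lblock det_ublock !det1 !mul1r.
Qed.

Lemma det_principal_submx1 A u :
  \det (principal_submx A [set u]) = A (enum_rank u) (enum_rank u).
Proof.
rewrite -[[set u]]setU0 det_principal_submxU1 ?inE //.
move: (principal_submx _ _) (\row_j _) (\col_i _); rewrite cards0 => D b c.
by rewrite [b]thinmx0 det_lblock det_mx11 !mxE det_mx00 mulr1.
Qed.

End PrincipalMinors.

(** * Hermitian matrices over GF(4) *)

Section Hermitian.

Local Open Scope ring_scope.

Variables (F : finFieldType) (V : finType).
Hypothesis hF : #|F| = 4%N.
Implicit Types (A : 'M[F]_#|V|) (X Y Z : {set V}) (M : set_system V) (u v : V).

Lemma oppr_GF4 (x : F) : - x = x.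
Proof.
(* Every element satisfies x^4 = x, and (-1)^4 = 1. *)
have N1 : -1 = 1 :> F by have := expf_card (-1 : F); rewrite hF -signr_odd expr0.
by rewrite -mulN1r N1 mul1r.
Qed.

Lemma addrr_GF4 (x : F) : x + x = 0.
Proof. by rewrite -{2}[x]oppr_GF4 subrr. Qed.

Lemma pchar_GF4 : 2 \in [pchar F].
Proof. by rewrite inE /= mulr2n addrr_GF4. Qed.

Lemma inv4M (x y : F) : inv4 (x * y) = inv4 x * inv4 y.
Proof. exact: exprMn. Qed.

Lemma inv4B (x y : F) : inv4 (x - y) = inv4 x - inv4 y.
Proof.
rewrite /inv4 oppr_GF4 sqrrD -mulr_natl mulrA (pcharf0 pchar_GF4) !mul0r addr0.
by rewrite oppr_GF4.
Qed.

Lemma inv_symmetricP n (A : 'M[F]_n) :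
  inv_symmetric A <-> forall i j, inv4 (A i j) = A j i.
Proof.
split=> [symA i j|symA]; first by rewrite -{2}symA !mxE oppr_GF4.
by apply/matrixP=> i j; rewrite !mxE oppr_GF4 symA.
Qed.

Lemma in_matrix_system A X :
  (X \in matrix_system A) = (\det (principal_submx A X) != 0).
Proof. by rewrite inE unitmxE unitfE. Qed.

(* The principal minors are fixed by the automorphism, so they lie in GF(2). *)
Lemma det_inv_symmetric A X : inv_symmetric A ->
  \det (principal_submx A X) = (X \in matrix_system A)%:R.
Proof.
move=> /inv_symmetricP symA; rewrite in_matrix_system; set d := \det _.
(* Squaring is the Frobenius map, so it commutes with the determinant, and by symmetry it turns the
   submatrix into its transpose. *)
have : d ^+ 2 = d.
  rewrite -[d ^+ 2]/(pFrobenius_aut pchar_GF4 d) -det_map_mx -[RHS]det_tr.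
  by congr (\det _); apply/matrixP=> i j; rewrite !mxE; exact: symA.
have [-> //|d0 /eqP] := eqVneq d 0.
by rewrite expr2 -{3}[d]mulr1 (inj_eq (mulfI d0)) => /eqP.
Qed.

(** * Closure properties of the untwisted systems of [inv]-symmetric matrices *)

Definition inv_symmetric_system M :=
  exists2 A : 'M[F]_#|V|, inv_symmetric A & M = matrix_system A.

Lemma inv_symmetric_system0 M : inv_symmetric_system M -> set0 \in M.
Proof. by move=> [A _ ->]; rewrite in_matrix_system det_principal_submx0 oner_neq0. Qed.

(** Adding 1 to the diagonal entry at [u] adds the minor on [Z] to the minor on [u |: Z]. Both lie
    in GF(2), where this sum is the exclusive or of the memberships. *)
Lemma inv_symmetric_system_loop_compl M u :
  inv_symmetric_system M -> inv_symmetric_system (loop_compl M u).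
Proof.
move=> [A symA ->]; pose A' := A + 1 *: delta_mx (enum_rank u) (enum_rank u).
have symA' : inv_symmetric A'.
  apply/inv_symmetricP=> i j; rewrite !mxE !mul1r -[X in _ + X]oppr_GF4 inv4B.
  rewrite (inv_symmetricP A).1 // oppr_GF4 andbC; congr (_ + _).
  by case: (_ && _); rewrite /inv4 ?expr1n ?expr0n.
exists A' => //; apply: (@eq_set_system1 _ u) => Z uZ; rewrite !(in_elementary _ uZ).
split; first by rewrite !in_matrix_system principal_submxD_delta.
rewrite [RHS]in_matrix_system det_principal_submxD_delta // mul1r.
rewrite !det_inv_symmetric //; case: (_ \in _); case: (_ \in _);
  by rewrite ?addrr_GF4 ?addr0 ?add0r ?oner_neq0 ?eqxx.
Qed.

Lemma inv_symmetric_system_pivot1 M u : inv_symmetric_system M ->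
  [set u] \in M -> inv_symmetric_system (pivot M [set u]).
Proof.
move=> [A symA ->] Au; set r := enum_rank u.
have Arr : A r r = 1.
  by rewrite -det_principal_submx1 det_inv_symmetric // Au.
(* Principal pivot transform for a pivot entry 1, its signs absorbed by characteristic 2: away from
   [r], [B] is the Schur complement of [A], while row and column [r] are kept. *)
pose B : 'M[F]_#|V| := \matrix_(i, j)
  if (i == r) || (j == r) then A i j else A i j - A i r * A r j.
have neq_u Z (i : 'I_#|Z|) : u \notin Z -> (enum_rank (enum_val i) == r) = false.
  move=> uZ; rewrite (inj_eq enum_rank_inj); apply/eqP => iu.
  by have := enum_valP i; rewrite iu (negPf uZ).
exists B.
  move/inv_symmetricP in symA; apply/inv_symmetricP=> i j; rewrite !mxE orbC.
  by case: ifP => _; rewrite ?inv4B ?inv4M !symA // mulrC.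
apply: (@eq_set_system1 _ u) => Z uZ; rewrite !(in_elementary _ uZ) !in_matrix_system.
rewrite !det_principal_submx_schur //; last by rewrite mxE eqxx.
split; congr (\det _ != 0); apply/matrixP=> i j; rewrite !mxE big_ord1 !mxE.
  by rewrite !neq_u.
(* The Schur complement of [B] subtracts the same product a second time, which restores [A]. *)
by rewrite !neq_u // !eqxx orbT -addrA -opprD addrr_GF4 subr0.
Qed.

Lemma inv_symmetric_system_exchange M X u : inv_symmetric_system M ->
    X \in M -> u \in X ->
  [set u] \in M \/ exists v, [/\ v \in X, v != u & [set u; v] \in M].
Proof.
move=> [A symA ->] MX uX; rewrite in_matrix_system det_principal_submx1.
have [Auu|] := eqVneq (A _ _) 0; [right|by left].
(* If no such [v] exists, row [u] of the nonsingular submatrix on [X] vanishes. *)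
have [v /andP[vX Auv]|A0] :=
  pickP [pred v in X | A (enum_rank u) (enum_rank v) != 0].
  have vu : v != u by apply: contraNneq Auv => ->; rewrite Auu.
  have uv : u \notin [set v] by rewrite inE eq_sym.
  exists v; split=> //; rewrite in_matrix_system.
  (* Since [A] vanishes at (u, u), adding 1 there gives a unit pivot, and a Schur complement
     applies. Comparing the two expressions, the minor on [[set u; v]] is minus the product of the
     entries at (v, u) and (u, v), which are conjugate and nonzero. *)
  have := det_principal_submxD_delta A 1 uv.
  rewrite det_principal_submx_schur //; last by rewrite !mxE Auu !eqxx add0r mulr1.
  rewrite !det_principal_submx1 mul1r => /eqP; rewrite -subr_eq => /eqP <-.
  rewrite !mxE big_ord1 !mxE !(inj_eq enum_rank_inj) (negPf vu) !andbF.
  rewrite !mulr0 !addr0.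
  rewrite addrAC subrr sub0r oppr_eq0 mulf_neq0 // -(inv_symmetricP A).1 //.
  by rewrite expf_neq0.
move: MX; rewrite in_matrix_system => /eqP[].
rewrite (expand_det_row _ (enum_rank_in uX u)) big1 // => j _.
rewrite !mxE enum_rankK_in //; have /= := A0 (enum_val j); rewrite enum_valP /=.
by move/negbFE/eqP->; rewrite mul0r.
Qed.

(* When neither {u} nor {v} is feasible, pivot on u and v by spelling the pivot
   on u as +u *u +u *u +u and inserting the pivot on v in the middle: then all
   pivots are on feasible singletons. *)
Lemma inv_symmetric_system_pivot2 M u v : inv_symmetric_system M ->
    v != u -> [set u] \notin M -> [set v] \notin M -> [set u; v] \in M ->
  inv_symmetric_system (pivot M [set u; v]).
Proof.
move=> CM vu Mu Mv Muv; have M0 := inv_symmetric_system0 CM.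
have uv : u \notin [set v] by rewrite inE eq_sym.
have vNu : v \notin [set u] by rewrite inE.
have u0 : u \notin set0 by rewrite inE.
have C1 := inv_symmetric_system_loop_compl u CM.
have /(inv_symmetric_system_pivot1 C1) C2 : [set u] \in loop_compl M u.
  by rewrite -[[set u]]setU0 in_loop_complU // setU0 (negPf Mu) M0.
have /(inv_symmetric_system_pivot1 C2) C3 :
    [set v] \in pivot (loop_compl M u) [set u].
  by rewrite in_pivot1 // in_loop_complU // Muv (negPf Mv).
have C4 := inv_symmetric_system_loop_compl u C3.
have /(inv_symmetric_system_pivot1 C4) C5 : [set u] \in
    loop_compl (pivot (pivot (loop_compl M u) [set u]) [set v]) u.
  rewrite -[[set u] in X in X \in _]setU0 in_loop_complU // setU0.
  rewrite (inv_symmetric_system0 C3) in_pivot1 // setUC in_pivot1U //.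
  by rewrite in_loop_compl0 // (negPf Mv).
have := inv_symmetric_system_loop_compl u C5.
rewrite (@pivot_loop_complC _ _ [set v]) // pivotM symdiffC -pivotM.
rewrite -pivot_loop_compl_braid.
rewrite pivot_loop_complC // loop_complK pivotM symdiff1 inE (negPf vu).
by rewrite setUC.
Qed.

(** Strong induction on the size of [X]: the exchange property yields a feasible subset of one or
    two elements, which is pivoted first. *)
Lemma inv_symmetric_system_pivot M X : inv_symmetric_system M ->
  X \in M -> inv_symmetric_system (pivot M X).
Proof.
have [n] := ubnP #|X|; elim: n => // n IHn in M X *; rewrite ltnS => leXn CM MX.
(* After the pivot on [W], the strictly smaller set [X :\: W] is feasible, and the induction
   hypothesis handles it. *)
have step (W : {set V}) u : u \in W -> W \subset X ->
    inv_symmetric_system (pivot M W) ->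
    inv_symmetric_system (pivot M X).
  move=> uW WX CMW; have XE : symdiff (X :\: W) W = X.
    apply/setP=> x; rewrite in_symdiff inE.
    by have := subsetP WX x; case: (x \in W) => //= [->|_]; rewrite ?addbF.
  rewrite -XE symdiffC -pivotM; apply: IHn => //; last by rewrite in_pivot XE.
  apply: leq_trans leXn; apply/proper_card/properP; split; first exact: subsetDl.
  by exists u; [exact: (subsetP WX) | rewrite inE uW].
have [->|[u uX]] := set_0Vmem X; first by rewrite pivot0.
have step1 w : w \in X -> [set w] \in M -> inv_symmetric_system (pivot M X).
  move=> wX Mw; apply: (step [set w] w); rewrite ?set11 ?sub1set //.
  exact: inv_symmetric_system_pivot1.
have [Mu|Mu] := boolP ([set u] \in M); first exact: step1 Mu.
have [|[v [vX vu Muv]]] := inv_symmetric_system_exchange CM MX uX.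
  by rewrite (negPf Mu).
have [Mv|Mv] := boolP ([set v] \in M); first exact: step1 Mv.
apply: (step [set u; v] u); first exact: set21.
  by apply/subsetP=> x /set2P[]->.
exact: inv_symmetric_system_pivot2.
Qed.

(** * Twists of these systems: the representable set systems *)

Lemma inv_representable_pivot M X :
  inv_representable F M -> inv_representable F (pivot M X).
Proof. by move=> [A [Y [symA ->]]]; rewrite pivotM; exists A, (symdiff Y X). Qed.

Lemma inv_representableW M : inv_symmetric_system M -> inv_representable F M.
Proof. by move=> [A symA ->]; exists A, set0; rewrite pivot0. Qed.

(** Any feasible set can thus be moved to the empty set without leaving the untwisted systems: [X]
    becomes the feasible set [symdiff Y X] of [matrix_system A]. *)
Lemma inv_representable_pivot_system M X : inv_representable F M ->
  X \in M -> inv_symmetric_system (pivot M X).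
Proof.
move=> [A [Y [symA ->]]]; rewrite in_pivot symdiffC pivotM.
by apply: inv_symmetric_system_pivot; exists A.
Qed.

Lemma inv_representable_loop_compl M u :
  inv_representable F M -> inv_representable F (loop_compl M u).
Proof.
move=> [A [X [symA ->]]]; set N := matrix_system A.
have CN : inv_symmetric_system N by exists A.
have [uX|uX] := boolP (u \in X); last first.
  rewrite pivot_loop_complC //; apply: inv_representable_pivot.
  exact/inv_representableW/inv_symmetric_system_loop_compl.
(* The part of the twist away from [u] commutes with loop complementation at [u], leaving only the
   pivot on [u] followed by loop complementation. *)
have -> : X = symdiff [set u] (X :\ u).
  by rewrite symdiffC symdiff1 setD11 setD1K.
rewrite -pivotM pivot_loop_complC ?setD11 //; apply: inv_representable_pivot.
have [Nu|Nu] := boolP ([set u] \in N).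
  apply/inv_representableW/inv_symmetric_system_loop_compl.
  exact: inv_symmetric_system_pivot1.
(* Here [[set u]] is infeasible in [N] but [set0] is feasible, so [[set u]] is feasible in
   [loop_compl N u], where the inner pivot takes place. *)
rewrite pivot_loop_compl_braid; apply/inv_representable_pivot/inv_representableW.
apply/inv_symmetric_system_loop_compl/inv_symmetric_system_pivot1.
  exact: inv_symmetric_system_loop_compl.
rewrite -[[set u]]setU0 in_loop_complU ?in_set0 // setU0 (negPf Nu).
exact: inv_symmetric_system0.
Qed.

(** Pivoting on [X] turns exchange from [X] towards [Y] into exchange from [set0] towards
    [symdiff X Y]. *)
Lemma inv_representable_delta_matroid M :
  inv_representable F M -> delta_matroid M.
Proof.
move=> repM; split.
  case: repM => A [X [symA ->]]; apply/eqP/set0Pn; exists X.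
  by rewrite in_pivot symdiffv; apply: inv_symmetric_system0; exists A.
move=> X Y MX MY u uXY; have CX := inv_representable_pivot_system repM MX.
have XY : symdiff X Y \in pivot M X by rewrite symdiffC in_pivot symdiffK.
have [|[v [vXY vu]]] := inv_symmetric_system_exchange CX XY uXY.
  by rewrite in_pivot symdiffC; left.
by rewrite in_pivot symdiffC; right; exists v; split=> //; apply/eqP.
Qed.

End Hermitian.

Theorem theorem6 (F : finFieldType) (hF : #|F| = 4) (V : finType)
    (M : set_system V) (hM : delta_matroid M)
    (hrep : inv_representable F M) (phi : seq (vertex_op V)) :
  delta_matroid (apply_ops M phi) /\ inv_representable F (apply_ops M phi).
Proof.
(* Representability implies the delta-matroid axioms and is preserved by each single operation. *)
suff rep : inv_representable F (apply_ops M phi).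
  by split=> //; exact: inv_representable_delta_matroid rep.
elim: phi M {hM} hrep => //= o phi IHphi M repM; apply: IHphi.
case: o => u /=; first exact: inv_representable_pivot.
exact: inv_representable_loop_compl.
Qed.
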